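(* Let $k$ be a field of characteristic $0$, let $\mu\in k^*$, and let $\Phi(X_0,X_1)=\sum_{W\in\{X_0,X_1\}^*}Z_W W\in k\langle\langle X_0,X_1\rangle\rangle$ be a group-like element whose coefficients in degree $1$ are zero. Put $X_\infty=-X_0-X_1$. Then the relation $$e^{\frac{\mu}{2}X_0}\Phi(X_\infty,X_0)e^{\frac{\mu}{2}X_\infty}\Phi(X_1,X_\infty)e^{\frac{\mu}{2}X_1}\Phi(X_0,X_1)=1$$ is equivalent to the family of relations: for all $W\in\{X_0,X_1\}^*\setminus\{\emptyset\}$, $$\sum_{\substack{W_1,\ldots,W_6\in\{X_0,X_1\}^*\\ W_1\cdots W_6=W}}\frac{\mu^{|W_1|}}{2^{|W_1|}|W_1|!}\tilde\alpha_0(W_1)\Bigg(\sum_{(\mathbf U,\mathbf k)\in \mathrm{dec}(W_2,X_0)}(-1)^{|\mathbf U|}Z_{X_0^{|U_1|}X_1^{k_1}\cdots X_0^{|U_p|}X_1^{k_p}}\Bigg)(-1)^{|W_3|}\frac{\mu^{|W_3|}}{2^{|W_3|}|W_3|!}$$ $$\times\Bigg(\sum_{(\mathbf V,\mathbf l)\in \mathrm{dec}(W_4,X_1)}(-1)^{|\mathbf V|}Z_{X_1^{|V_1|}X_0^{l_1}\cdots X_1^{|V_p|}X_0^{l_p}}\Bigg)\frac{\mu^{|W_5|}}{2^{|W_5|}|W_5|!}\tilde\alpha_1(W_5)\,Z_{W_6}=0 .$$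
   Context: $k\langle\langle X_0,X_1\rangle\rangle$ is the ring of formal power series in two non-commutative variables; $\{X_0,X_1\}^*$ is the set of words in $X_0,X_1$ (including the empty word $\emptyset$, identified with $1$), and $|W|$ is the length of $W$. The coproduct $\Delta$ is the continuous algebra morphism with $\Delta(X_i)=X_i\otimes 1+1\otimes X_i$, and $\Phi$ is group-like if $\Delta(\Phi)=\Phi\hat\otimes\Phi$; in particular $Z_\emptyset=1$. $\Phi(A,B)$ denotes the image of $\Phi$ under the substitution $X_0\mapsto A$, $X_1\mapsto B$. For $i\in\{0,1\}$, $\alpha_i$ is the endomorphism of $k\langle\langle X_0,X_1\rangle\rangle$ with $\alpha_i(X_i)=X_i$ and $\alpha_i(X_{1-i})=0$; $\tilde\alpha_i$ is the composition of $\alpha_i$ with $X_0,X_1\mapsto 1$. Thus for a word $W$, $\tilde\alpha_i(W)=1$ if $W$ is a power $X_i^n$ ($n\ge 0$) and $\tilde\alpha_i(W)=0$ otherwise. For a word $W$ and $i\in\{0,1\}$, $\mathrm{dec}(W,X_i)$ is the set of tuples $(V_1,X_i^{k_1},V_2,X_i^{k_2},\ldots,V_p,X_i^{k_p})$ (also written $(\mathbf V,\mathbf k)$) with $1\le p<\infty$, $V_j\in\{X_0,X_1\}^*$, $V_2,\ldots,V_p\ne\emptyset$, $k_1,\ldots,k_{p-1}>0$, $k_p\ge 0$, and $W=V_1X_i^{k_1}V_2X_i^{k_2}\cdots V_pX_i^{k_p}$. We write $|\mathbf V|=|V_1|+\cdots+|V_p|$. *)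

(* Defs.v *)
From HB Require Import structures.
From mathcomp Require Import all_boot all_algebra.
From mathcomp Require Import zify.
From mathcomp Require Import boolp classical_sets functions cardinality fsbigop.

Set Implicit Arguments.
Unset Strict Implicit.
Unset Printing Implicit Defensive.

Import GRing.Theory.
Local Open Scope ring_scope.
Local Open Scope classical_set_scope.

(* The letters X_0 and X_1 are the booleans false and true, so that X_{1-i} is
   ~~ i; the empty word is [::]. *)
Notation word := (seq bool).

(* f W is the coefficient of the word W in f.  The coefficients may lie in a
   noncommutative ring R, whose elements commute with the two letters. *)
Definition ncseries (R : Type) : Type := word -> R.

HB.instance Definition _ (R : Type) := gen_eqMixin (ncseries R).
HB.instance Definition _ (R : Type) := gen_choiceMixin (ncseries R).

Section ZmodStructure.
Variable R : zmodType.
Implicit Types f g h : ncseries R.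

Definition nc_zero : ncseries R := fun=> 0.
Definition nc_opp f : ncseries R := fun W => - f W.
Definition nc_add f g : ncseries R := fun W => f W + g W.

Lemma nc_addA : associative nc_add.
Proof. by move=> f g h; apply/funext => W; exact: addrA. Qed.
Lemma nc_addC : commutative nc_add.
Proof. by move=> f g; apply/funext => W; exact: addrC. Qed.
Lemma nc_add0 : left_id nc_zero nc_add.
Proof. by move=> f; apply/funext => W; exact: add0r. Qed.
Lemma nc_addN : left_inverse nc_zero nc_opp nc_add.
Proof. by move=> f; apply/funext => W; exact: addNr. Qed.

HB.instance Definition _ :=
  GRing.isZmodule.Build (ncseries R) nc_addA nc_addC nc_add0 nc_addN.

Lemma nc_addE f g W : (f + g) W = f W + g W. Proof. by []. Qed.
Lemma nc_oppE f W : (- f) W = - f W. Proof. by []. Qed.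
Lemma nc_zeroE W : (0 : ncseries R) W = 0. Proof. by []. Qed.

End ZmodStructure.

Section RingStructure.
Variable R : nzRingType.
Implicit Types (f g h : ncseries R) (W : word).

Definition monom W : ncseries R := fun V => (V == W)%:R.

Definition nc_one : ncseries R := monom [::].
Definition nc_mul f g : ncseries R :=
  fun W => \sum_(i < (size W).+1) f (take i W) * g (drop i W).
Definition nc_scale (c : R) f : ncseries R := fun W => c * f W.

Let shift b f : ncseries R := fun W => f (b :: W).

Let mul_nil f g : nc_mul f g [::] = f [::] * g [::].
Proof. by rewrite /nc_mul big_ord_recl big_ord0 addr0. Qed.

Let mul_cons f g b W :
  nc_mul f g (b :: W) = f [::] * g (b :: W) + nc_mul (shift b f) g W.
Proof. by rewrite /nc_mul big_ord_recl. Qed.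

Lemma nc_mulDl : left_distributive nc_mul +%R.
Proof.
move=> f g h; apply/funext => W; rewrite nc_addE /nc_mul -big_split.
by apply: eq_bigr => i _; exact: mulrDl.
Qed.

Lemma nc_mulDr : right_distributive nc_mul +%R.
Proof.
move=> f g h; apply/funext => W; rewrite nc_addE /nc_mul -big_split.
by apply: eq_bigr => i _; exact: mulrDr.
Qed.

Lemma nc_scaleAl c f g : nc_scale c (nc_mul f g) = nc_mul (nc_scale c f) g.
Proof.
apply/funext => W; rewrite /nc_scale /nc_mul big_distrr.
by apply: eq_bigr => i _; exact: mulrA.
Qed.

Lemma nc_mulA : associative nc_mul.
Proof.
move=> f g h; apply/funext => W; elim: W f g h => [|b W IH] f g h.
  by rewrite !mul_nil mulrA.
rewrite !mul_cons IH mul_nil mulrDr -addrA mulrA; congr (_ + _).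
have -> : shift b (nc_mul f g) =
    nc_scale (f [::]) (shift b g) + nc_mul (shift b f) g.
  by apply/funext => V; rewrite /shift mul_cons.
by rewrite nc_mulDl nc_addE -nc_scaleAl.
Qed.

Lemma nc_mul1f : left_id nc_one nc_mul.
Proof.
move=> f; apply/funext => W; rewrite /nc_mul big_ord_recl take0 drop0.
rewrite /nc_one /monom eqxx mul1r big1 ?addr0// => i _.
by case: W i => [|b W] i; [case: i | rewrite mul0r].
Qed.

Lemma nc_mulf1 : right_id nc_one nc_mul.
Proof.
move=> f; apply/funext => W; rewrite /nc_mul big_ord_recr take_size drop_size.
rewrite /nc_one /monom eqxx mulr1 /= big1 ?add0r// => i _.
by rewrite -size_eq0 size_drop subn_eq0 leqNgt ltn_ord mulr0.
Qed.

Lemma nc_one_neq0 : nc_one != 0 :> ncseries R.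
Proof.
apply/eqP => /(congr1 (fun f : ncseries R => f [::])) /eqP.
by rewrite /nc_one /monom eqxx nc_zeroE oner_eq0.
Qed.

HB.instance Definition _ := GRing.Zmodule_isNzRing.Build (ncseries R)
  nc_mulA nc_mul1f nc_mulf1 nc_mulDl nc_mulDr nc_one_neq0.

Lemma nc_scaleA a b f : nc_scale a (nc_scale b f) = nc_scale (a * b) f.
Proof. by apply/funext => W; exact: mulrA. Qed.
Lemma nc_scale1 : left_id 1 nc_scale.
Proof. by move=> f; apply/funext => W; exact: mul1r. Qed.
Lemma nc_scaleDr : right_distributive nc_scale +%R.
Proof. by move=> a f g; apply/funext => W; exact: mulrDr. Qed.
Lemma nc_scaleDl f : {morph nc_scale^~ f : a b / a + b}.
Proof. by move=> a b; apply/funext => W; exact: mulrDl. Qed.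

HB.instance Definition _ := GRing.Zmodule_isLmodule.Build R (ncseries R)
  nc_scaleA nc_scale1 nc_scaleDr nc_scaleDl.
HB.instance Definition _ :=
  GRing.Lmodule_isLalgebra.Build R (ncseries R) nc_scaleAl.

Lemma nc_oneE W : (1 : ncseries R) W = (W == [::])%:R. Proof. by []. Qed.
Lemma nc_mulE f g W :
  (f * g) W = \sum_(i < (size W).+1) f (take i W) * g (drop i W).
Proof. by []. Qed.
Lemma nc_scaleE c f W : (c *: f) W = c * f W. Proof. by []. Qed.

Definition X (b : bool) : ncseries R := monom [:: b].
Definition Xoo : ncseries R := - X false - X true.

End RingStructure.

Definition wordprod (A : nzRingType) (a : bool -> A) (W : word) : A :=
  \prod_(b <- W) a b.

Lemma fsum_single (V : zmodType) (T : choiceType) (x : T) (F : T -> V) :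
  (forall y, y != x -> F y = 0) -> \sum_(y \in [set: T]) F y = F x.
Proof.
move=> F0; rewrite -(@fsbig_widen _ _ _ _ [set x])// ?fsbig_set1//.
by move=> y [_ /= /eqP /F0].
Qed.

Section Operations.
Variable k : fieldType.
Implicit Types (a f g : ncseries k) (W : word).

(* Infinite sums of series are taken coefficientwise. A finitely supported sum
   \sum_(i \in A) is 0 when infinitely many terms are nonzero; this does not
   happen for the coefficients of f(A, B) and of e^A when the constant terms of
   A and B vanish, nor for those of Delta(f); see wordprod_small, exp_small and
   coproduct_small. *)

Definition subst f (A B : ncseries k) : ncseries k :=
  fun V => \sum_(W \in [set: word])
    f W * wordprod (fun b => if b then B else A) W V.

Definition ncexp a : ncseries k :=
  fun V => \sum_(n \in [set: nat]) (n`!%:R)^-1 * (a ^+ n) V.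

(* The completed tensor square of k<<X_0, X_1>> is the ring of series in X_0, X_1
   with coefficients in k<<X_0, X_1>>: the coefficient of F at U (x) V is F U V,
   and (F * G) U V is the sum of F U1 V1 * G U2 V2 over all factorizations
   U = U1 U2, V = V1 V2. *)
Definition tensor f g : ncseries (ncseries k) := fun U => f U *: g.

Definition coproduct f : ncseries (ncseries k) :=
  fun U V => \sum_(W \in [set: word])
    f W * wordprod (fun b => tensor (X k b) 1 + tensor 1 (X k b)) W U V.

(* The normalization excludes the solution 0 of Delta(f) = f (x) f. *)
Definition group_like f : Prop :=
  f [::] = 1 /\ coproduct f = tensor f f.

Definition alpha (i : bool) f : ncseries k :=
  subst f (if i then 0 else X k false) (if i then X k true else 0).

(* Substituting 1 for X_0 and X_1 amounts to adding up the coefficients; it is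
   only meaningful for polynomials. *)
Definition eval1 f : k := \sum_(V \in [set: word]) f V.

Definition alphat (i : bool) W : k := eval1 (alpha i (monom k W)).

Lemma nc_mul_small (R : nzRingType) (F G : ncseries R) (V : word) (n : nat) :
  F [::] = 0 -> (forall V', (size V' < n)%N -> G V' = 0) ->
  (size V < n.+1)%N -> (F * G) V = 0.
Proof.
move=> F0 Gn Vn; rewrite nc_mulE big1// => i _.
case: (posnP i) => [->|i0]; first by rewrite take0 F0 mul0r.
rewrite Gn ?mulr0// size_drop; have := ltn_ord i; rewrite ltnS => iV.
rewrite ltnS in Vn; apply: leq_trans Vn; rewrite ltn_subrL i0.
exact: leq_trans iV.
Qed.

Lemma wordprod_small (A B : ncseries k) W V : A [::] = 0 -> B [::] = 0 ->
  (size V < size W)%N -> wordprod (fun b => if b then B else A) W V = 0.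
Proof.
move=> A0 B0; elim: W V => [|b W IH] V //= VW.
rewrite /wordprod big_cons; apply: nc_mul_small VW; first by case: b.
exact: IH.
Qed.

Lemma exp_small a n V : a [::] = 0 -> (size V < n)%N -> (a ^+ n) V = 0.
Proof.
move=> a0; elim: n V => [|n IH] V //= Vn.
by rewrite exprS; apply: nc_mul_small Vn.
Qed.

Lemma coproduct_small W U V : (size U + size V < size W)%N ->
  wordprod (fun b => tensor (X k b) 1 + tensor 1 (X k b)) W U V = 0.
Proof.
elim: W U V => [|b W IH] U V //= UVW; rewrite /wordprod big_cons -/(wordprod _ W).
set D := wordprod _ W in IH *.
have sumE (I : Type) (r : seq I) (F : I -> ncseries k) (T : word) :
    (\sum_(i <- r) F i) T = \sum_(i <- r) F i T.
  by elim/big_rec2 : _ => // i x y _ <-.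
rewrite mulrDl nc_addE nc_addE !nc_mulE !sumE !big1 ?addr0// => i _.
  rewrite /tensor nc_oneE; case: eqP => [Ui|_]; last first.
    by rewrite scale0r mul0r.
  have i0 : i = 0%N :> nat.
    by have := congr1 size Ui; rewrite size_takel// -ltnS.
  rewrite i0 drop0 scale1r; apply: (@nc_mul_small _ _ _ _ (size W - size U)).
  - by [].
  - move=> V' V'W; apply: IH; rewrite addnC.
    by move: V'W; rewrite ltn_subRL addnC.
  - move: UVW; rewrite !ltnS => UVW; rewrite leq_subRL//.
    exact: leq_trans (leq_addr _ _) UVW.
rewrite /tensor /X /monom; case: eqP => [Ui|_]; last by rewrite scale0r mul0r.
rewrite scale1r mul1r IH//.
have sU : size U = (size (drop i U)).+1.
  by have := congr1 size (cat_take_drop i U); rewrite size_cat Ui.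
by lia.
Qed.

Lemma alphatE i W : alphat i W = (W == nseq (size W) i)%:R.
Proof.
rewrite /alphat /eval1 /alpha.
have E U V : wordprod (fun b => if b then (if i then X k true else 0)
      else (if i then 0 else X k false)) U V =
    ((U == nseq (size U) i) && (V == U))%:R.
  elim: U V => [|b U IH] V; first by rewrite /wordprod big_nil nc_oneE.
  rewrite /wordprod big_cons eqseq_cons.
  have -> : (if b then if i then X k true else 0 else if i then 0 else X k false)
      = if b == i then X k b else 0 by clear; case: b; case: i.
  case: eqP => [->|_]; last by rewrite mul0r.
  rewrite nc_mulE; case: V => [|c V].
    by rewrite big_ord_recl big_ord0 addr0 /X /monom mul0r andbF.
  rewrite big_ord_recl big_ord_recl /= take0 /X /monom mul0r add0r /= drop0.
  rewrite -/(wordprod _ U) IH big1 => [|j _]; last first.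
    by case: V j => [|d V] j; [case: j | rewrite /= eqseq_cons andbF mul0r].
  rewrite addr0 eqseq_cons -natrM mulnb; congr (nat_of_bool _)%:R.
  by rewrite ?take0 ?eqxx ?eqseq_cons ?andbT; case: (c == i); rewrite /= ?andbF.

have S V : subst (monom k W) (if i then 0 else X k false)
      (if i then X k true else 0) V =
    ((W == nseq (size W) i) && (V == W))%:R.
  rewrite /subst (fsum_single (x := W)) => [|U /negPf UW].
    by rewrite /monom eqxx mul1r E.
  by rewrite /monom UW mul0r.
rewrite (fsum_single (x := W)) => [|U /negPf UW]; first by rewrite S eqxx andbT.
by rewrite S UW andbF.
Qed.

End Operations.

(* A tuple (V_1, X_i^{k_1}, ..., V_p, X_i^{k_p}) is the list of the pairs
   (V_j, k_j). *)
Definition dec (W : word) (i : bool) : set (seq (word * nat)) :=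
  [set d | [/\ d != [::],
               all (fun x => x.1 != [::]) (behead d),
               all (fun x => (0 < x.2)%N) (take (size d).-1 d)
             & flatten [seq x.1 ++ nseq x.2 i | x <- d] = W]].

Lemma finite_seqs (T : Type) (A : set T) (n : nat) : finite_set A ->
  finite_set [set s : seq T | (size s <= n)%N /\ forall x, List.In x s -> A x].
Proof.
move=> finA; elim: n => [|n IH].
  apply: (@sub_finite_set _ _ [set [::]]) => // s [/= s0 _].
  by case: s s0.
apply: (@sub_finite_set _ _ ([set [::]] `|`
  ((fun u => u.1 :: u.2) @` (A `*` [set s : seq T | (size s <= n)%N /\
     forall x, List.In x s -> A x])))).
  move=> [|x s] [/= sn sA]; [by left|right; exists (x, s) => //=].
  by split=> /=; [apply: sA; left|split=> // y ys; apply: sA; right].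
by rewrite finite_setU; split=> //; apply/finite_image/finite_setX.
Qed.

Lemma finite_words (n : nat) : finite_set [set V : word | (size V <= n)%N].
Proof.
apply: sub_finite_set (finite_seqs n (@finite_finset _ [set: bool])).
by move=> V /= Vn; split.
Qed.

Lemma finite_dec W i : finite_set (dec W i).
Proof.
pose n := size W.
have finA : finite_set ([set V : word | (size V <= n)%N] `*` [set m | (m <= n)%N]).
  apply: finite_setX; first exact: finite_words.
  by apply: sub_finite_set (finite_II n.+1) => m /=; rewrite ltnS.
apply: sub_finite_set (finite_seqs n.+1 finA) => d [_ dV _ dW] /=.
have {}dW : size (flatten [seq x.1 ++ nseq x.2 i | x <- d]) = n by rewrite dW.
rewrite size_flatten /shape -map_comp in dW.
split=> [|x xd]; last first.
  suff : (size x.1 + x.2 <= n)%N.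
    by move=> h; split; apply: leq_trans h; rewrite ?leq_addr ?leq_addl.
  rewrite -dW; elim: d xd {dV dW} => //= y d IH [->|/IH h].
    by rewrite size_cat size_nseq leq_addr.
  exact: leq_trans (leq_addl _ _).
case: d dV dW => [|x d]//= dV dW; rewrite ltnS -dW.
apply: leq_trans (leq_addl _ _).
elim: d dV {dW} => //= y d IH /andP[y0 /IH]; rewrite -(leq_add2l 1) => h.
apply: leq_trans h _; rewrite leq_add2r size_cat addn_gt0.
by rewrite lt0n size_eq0 y0.
Qed.

Definition dec_size (d : seq (word * nat)) : nat :=
  sumn [seq size x.1 | x <- d].

(* X_i^{|V_1|} X_{1-i}^{k_1} ... X_i^{|V_p|} X_{1-i}^{k_p} *)
Definition dec_word (i : bool) (d : seq (word * nat)) : word :=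
  flatten [seq nseq (size x.1) i ++ nseq x.2 (~~ i) | x <- d].

Definition dec_sum (k : fieldType) (Z : ncseries k) (i : bool) (W : word) : k :=
  \sum_(d \in dec W i) (- 1) ^+ dec_size d * Z (dec_word i d).

Definition factorizations6 (W : word) :
    set (word * word * word * word * word * word) :=
  [set w | let: (W1, W2, W3, W4, W5, W6) := w in
           W1 ++ W2 ++ W3 ++ W4 ++ W5 ++ W6 = W].

Lemma finite_factorizations6 W : finite_set (factorizations6 W).
Proof.
have fin := finite_words (size W); set A := [set V | _] in fin.
apply: (@sub_finite_set _ _ (A `*` A `*` A `*` A `*` A `*` A)).
  move=> [[[[[W1 W2] W3] W4] W5] W6] /= /(congr1 size).
  by rewrite !size_cat /A /= => <-; rewrite -!andA; do !split; lia.
by do !apply: finite_setX.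
Qed.

(* Main.v *)
Require Import Defs.
From mathcomp Require Import all_boot all_algebra.
From mathcomp Require Import boolp classical_sets functions cardinality fsbigop.

Set Implicit Arguments.
Unset Strict Implicit.
Unset Printing Implicit Defensive.

Import GRing.Theory.
Local Open Scope ring_scope.
Local Open Scope classical_set_scope.

(** Write P for the product of the six series.  Its constant term is 1, so P = 1
    means that P has no other nonzero coefficient ([eq1_positive_degree]), and
    the relation indexed by W turns out to say exactly that the coefficient of
    W in P vanishes.  So the theorem is a computation of that coefficient.

    The coefficient of W in a product of six series is a sum over the
    factorizations of W into six words ([sums_over_mul]), and each factor
    contributes one of the six terms of the relation.

    All the series substituted or exponentiated are homogeneous of degree 1, so
    the coefficient of V in a product of n of them is 0 unless V has n letters,
    and otherwise is a product of n scalars, one for each letter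
    ([wordprod_linear]).  For the exponentials this gives (mu/2)^n / n! times
    the indicator of the powers of a letter ([ncexp_X]), or times (-1)^n,
    since -X_0 - X_1 gives the coefficient -1 to both letters ([ncexp_Xoo]).

    For Phi(X_oo, X_0) and Phi(X_1, X_oo), let i be 0 and 1 respectively: the
    letter X_i is replaced by X_oo and the letter X_{1-i} by X_i.  Hence a word
    U contributes to the coefficient of W only if |U| = |W| and W has the letter
    X_i wherever U has X_{1-i}; the contribution is then Z_U times one sign for
    each X_i in U.  Cutting such a U into its maximal runs, and W at the same
    places, gives an element (V, k) of dec(W, X_i): the word W is free below the
    runs of X_i, which are the V_j, and is X_i^{k_j} below the runs of X_{1-i}.
    The conditions V_j nonempty for j > 1 and k_j > 0 for j < p are maximality
    of the runs, so this is a bijection ([dec_word_bij]) and the coefficient is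
    the sum over dec(W, X_i) of the relation ([subst_dec_sum]). *)

(** * Products of series as sums over factorizations *)

(** The fibre of [p] over W stands for the factorizations of W of a given shape.
    Keeping [p] and [T] abstract allows the factors of a product to be added one
    at a time.  Finiteness is part of the predicate because a sum over an
    infinite support would be 0 by convention. *)
Definition sums_over (R : nzRingType) (T : choiceType) (p : T -> word)
    (G : T -> R) (f : ncseries R) : Prop :=
  forall W, finite_set [set t | p t = W] /\
    f W = \sum_(t \in [set t | p t = W]) G t.

Lemma sums_over_self (R : nzRingType) (f : ncseries R) : sums_over id f f.
Proof.
move=> W; have -> : [set V : word | id V = W] = [set W].
  by apply/seteqP; split=> V.
by split; [exact: finite_set1 | rewrite fsbig_set1].
Qed.

(** A factorization of W of the larger shape is a cut of W into two words
    together with a factorization of the first one; the cut is determined by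
    the length of the first word. *)
Lemma sums_over_mul (R : nzRingType) (T : choiceType) (p : T -> word)
    (G : T -> R) (f g : ncseries R) :
  sums_over p G f ->
  sums_over (fun x : T * word => p x.1 ++ x.2)
    (fun x => G x.1 * g x.2) (f * g).
Proof.
move=> fG W.
pose fiber V : seq T := finmap.enum_fset (fset_set [set t | p t = V]).
have in_fiber V t : (t \in fiber V) = (p t == V).
  have [fin _] := fG V.
  by rewrite /fiber in_fset_set//; apply/idP/eqP; rewrite inE.
pose r := [seq (t, drop i W) | i <- iota 0 (size W).+1, t <- fiber (take i W)].
have r_uniq : uniq r.
  apply: allpairs_uniq_dep; first exact: iota_uniq.
    by move=> i _; exact: finmap.fset_uniq.
  have size_first (q : {i : nat & T}) :
      q \in [seq @Tagged nat i (fun=> T) t | i <- iota 0 (size W).+1,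
                                      t <- fiber (take i W)] ->
      size (p (tagged q)) = tag q.
    move=> /allpairsPdep[i [t [iW ti qE]]]; move: iW ti; rewrite {}qE.
    rewrite mem_iota in_fiber add0n ltnS => /andP[_ iW] /eqP ->.
    exact: size_takel.
  move=> [i t] [j u] /size_first /= ti /size_first /= uj [tu _].
  by move: ti uj; rewrite tu => <- <-.
have r_mem x : p x.1 ++ x.2 = W -> x \in r.
  case: x => t V /= ptV; apply/allpairsPdep; exists (size (p t)), t.
  rewrite mem_iota in_fiber -ptV take_size_cat// drop_size_cat// eqxx.
  by rewrite add0n ltnS size_cat leq_addr.
split; first exact: sub_finite_set r_mem (finite_seq r).
rewrite (@fsbig_fwiden _ _ _ _ r)//; last first.
  move=> _ [/allpairsPdep[i [t [_ + ->]]]] /=.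
  by rewrite in_fiber => /eqP -> []; exact: cat_take_drop.
rewrite nc_mulE big_allpairs_dep -(big_mkord xpredT
  (fun i => f (take i W) * g (drop i W))) /index_iota subn0.
apply: eq_bigr => i _; have [fin ->] := fG (take i W).
by rewrite fsbig_finite// big_distrl.
Qed.

(** * Series concentrated in degree one *)

Definition linear_series (R : nzRingType) (a : ncseries R) : Prop :=
  forall V, size V != 1%N -> a V = 0.

(** Of all cuts of the word, only the one after the first letter contributes. *)
Lemma mul_linear_cons (R : nzRingType) (a f : ncseries R) (b : bool)
    (V : word) :
  linear_series a -> (a * f) (b :: V) = a [:: b] * f V.
Proof.
move=> a1; rewrite nc_mulE /= big_ord_recl a1// mul0r add0r big_ord_recl /=.
rewrite take0 drop0 big1 ?addr0// => i _.
by rewrite a1 ?mul0r//=; case: V i => [[]|].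
Qed.

Lemma wordprod_linear (R : nzRingType) (a : bool -> ncseries R) (U V : word) :
  (forall b, linear_series (a b)) ->
  wordprod a U V = if size U == size V
                   then \prod_(q <- zip U V) a q.1 [:: q.2] else 0.
Proof.
move=> a1; rewrite /wordprod; elim: U V => [|b U IH] V.
  by rewrite big_nil nc_oneE; case: V => [|c V]; rewrite //= big_nil.
rewrite big_cons; case: V => [|c V].
  by rewrite nc_mulE big_ord_recl big_ord0 addr0 /= (a1 b) ?mul0r.
rewrite mul_linear_cons// IH /= eqSS; case: ifP; last by rewrite mulr0.
by rewrite big_cons.
Qed.

Lemma expr_linear (R : nzRingType) (a : ncseries R) n V :
  linear_series a ->
  (a ^+ n) V = if n == size V then \prod_(b <- V) a [:: b] else 0.
Proof.
move=> a1; have -> : a ^+ n = wordprod (fun=> a) (nseq n true).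
  by rewrite /wordprod big_nseq; elim: n => //= n IH; rewrite exprS IH.
rewrite wordprod_linear// size_nseq; case: eqP => // ->.
by elim: V => [|b V IH]; rewrite /= ?big_nil// !big_cons IH.
Qed.

Lemma ncexp_linear (k : fieldType) (a : ncseries k) V : linear_series a ->
  ncexp a V = ((size V)`!%:R)^-1 * \prod_(b <- V) a [:: b].
Proof.
move=> a1; rewrite /ncexp (fsum_single (x := size V)) => [|n /negPf nV].
  by rewrite expr_linear// eqxx.
by rewrite expr_linear// nV mulr0.
Qed.

Lemma X_letter (R : nzRingType) (b c : bool) : X R b [:: c] = (c == b)%:R.
Proof. by rewrite /X /monom eqseq_cons andbT. Qed.

Lemma Xoo_letter (R : nzRingType) (c : bool) : Xoo R [:: c] = -1.
Proof.
rewrite /Xoo nc_addE !nc_oppE !X_letter.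
by case: c; rewrite ?oppr0 ?add0r ?addr0.
Qed.

Lemma linear_X (R : nzRingType) (b : bool) : linear_series (X R b).
Proof. by move=> V V1; rewrite /X /monom; case: (V =P [:: b]) V1 => [->|]. Qed.

Lemma linear_Xoo (R : nzRingType) : linear_series (Xoo R).
Proof.
by move=> V V1; rewrite /Xoo nc_addE !nc_oppE !linear_X// oppr0 addr0.
Qed.

Lemma linear_scale (R : nzRingType) (c : R) (a : ncseries R) :
  linear_series a -> linear_series (c *: a).
Proof. by move=> a1 V V1; rewrite nc_scaleE a1 ?mulr0. Qed.

Lemma exp_coef (k : fieldType) (mu : k) n :
  (n`!%:R)^-1 * (mu / 2%:R) ^+ n = mu ^+ n / (2 ^ n * n`!)%:R.
Proof. by rewrite natrM natrX invfM expr_div_n mulrC mulrA. Qed.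

Lemma ncexp_X (k : fieldType) (mu : k) (b : bool) V :
  ncexp ((mu / 2%:R) *: X k b) V =
  mu ^+ size V / (2 ^ size V * (size V)`!)%:R * alphat k b V.
Proof.
rewrite ncexp_linear; last exact/linear_scale/linear_X.
rewrite -exp_coef -mulrA alphatE; congr (_ * _).
elim: V => [|c V IH]; first by rewrite big_nil mul1r eqxx.
rewrite big_cons IH nc_scaleE X_letter /= exprS eqseq_cons -mulnb natrM.
by rewrite mulrACA.
Qed.

Lemma ncexp_Xoo (k : fieldType) (mu : k) V :
  ncexp ((mu / 2%:R) *: Xoo k) V =
  (-1) ^+ size V * (mu ^+ size V / (2 ^ size V * (size V)`!)%:R).
Proof.
rewrite ncexp_linear; last exact/linear_scale/linear_Xoo.
rewrite -exp_coef mulrCA; congr (_ * _).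
elim: V => [|c V IH]; first by rewrite big_nil !expr0 mul1r.
rewrite big_cons IH nc_scaleE Xoo_letter /= !exprS.
by rewrite [X in X * _ = _]mulrC mulrACA.
Qed.

Lemma subst_X (k : fieldType) (f : ncseries k) :
  subst f (X k false) (X k true) = f.
Proof.
have coef U V : wordprod (fun b => if b then X k true else X k false) U V =
    (U == V)%:R.
  rewrite wordprod_linear; last by case; exact: linear_X.
  elim: U V => [|b U IH] [|c V] //=; first by rewrite big_nil.
  rewrite eqSS big_cons eqseq_cons -mulnb natrM -IH.
  have -> : (if b then X k true else X k false) = X k b by case: b.
  by rewrite X_letter [c == b]eq_sym; case: ifP; rewrite ?mulr0.
apply/funext => V; rewrite /subst (fsum_single (x := V)) => [|U /negPf UV].
  by rewrite coef eqxx mulr1.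
by rewrite coef UV mulr0.
Qed.

(** * Decompositions of a word and runs of letters *)

(** Neither W alone nor [dec_word i d] alone determines d: a letter X_i of W may
    belong to some V_j or to a power, and [dec_word i d] forgets the letters of
    the V_j.  The sequence of the pairs (letter of [dec_word i d], letter of W)
    determines it, and is the object to which [runs] gives an inverse map. *)
Definition labelled_blocks (i : bool) (d : seq (word * nat)) :
    seq (bool * bool) :=
  flatten [seq [seq (i, b) | b <- x.1] ++ nseq x.2 (~~ i, i) | x <- d].

(** Cuts a sequence of pairs at the runs of its first components.  The scan goes
    from right to left: a pair starting with i extends the first V, and the
    other pairs extend the first power, unless a nonempty V separates them from
    it, in which case they open a new block.  The initial block is there because
    V_1 may be empty and k_p may be 0, even both when W is empty. *)
Definition runs (i : bool) : seq (bool * bool) -> seq (word * nat) :=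
  foldr (fun q d => let x := head ([::], 0%N) d in
    if q.1 == i then (q.2 :: x.1, x.2) :: behead d
    else if x.1 is [::] then ([::], x.2.+1) :: behead d
    else ([::], 1%N) :: d) [:: ([::], 0%N)].

Definition normal (d : seq (word * nat)) : Prop :=
  [/\ d != [::], all (fun x => x.1 != [::]) (behead d)
    & all (fun x => (0 < x.2)%N) (take (size d).-1 d)].

(** The first component of a pair stands for a letter of Phi and the second for
    a letter of the result: i becomes X_oo, which contains both letters, while
    the other letter becomes X_i. *)
Definition compatible (i : bool) (s : seq (bool * bool)) : bool :=
  all (fun q => (q.1 == i) || (q.2 == i)) s.

Lemma unzip1_labelled_blocks i d : unzip1 (labelled_blocks i d) = dec_word i d.
Proof.
elim: d => //= x d IH; rewrite /labelled_blocks /= /unzip1 map_cat.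
rewrite [map _ (flatten _)]IH map_cat map_nseq -map_comp /dec_word /=.
by congr ((_ ++ _) ++ _); elim: x.1 => //= b V ->.
Qed.

Lemma unzip2_labelled_blocks i d :
  unzip2 (labelled_blocks i d) = flatten [seq x.1 ++ nseq x.2 i | x <- d].
Proof.
elim: d => //= x d IH; rewrite /labelled_blocks /= /unzip2 map_cat.
rewrite [map _ (flatten _)]IH map_cat map_nseq -map_comp /=.
by rewrite (eq_map (g := id))// map_id.
Qed.

Lemma compatible_labelled_blocks i d : compatible i (labelled_blocks i d).
Proof.
elim: d => //= x d IH.
rewrite /compatible /labelled_blocks /= all_cat [all _ (flatten _)]IH.
rewrite all_cat all_map all_nseq /= !eqxx !orbT /= !andbT.
by apply/allP => b _ /=; rewrite eqxx.
Qed.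

Lemma count_labelled_blocks i d :
  count (fun q => q.1 == i) (labelled_blocks i d) = dec_size d.
Proof.
elim: d => //= x d IH.
rewrite /labelled_blocks /= count_cat [count _ (flatten _)]IH.
have powers0 : count (fun q => q.1 == i) (nseq x.2 (~~ i, i)) = 0%N.
  by rewrite count_nseq; case: (i).
rewrite count_cat count_map powers0 addn0; congr (_ + _)%N.
by rewrite (eq_count (a2 := predT)) ?count_predT// => b; rewrite /= eqxx.
Qed.

Lemma runs_normal i s : normal (runs i s).
Proof.
elim: s => [|q s [d0 dV dk]] //=; move: d0 dV dk.
case: (runs i s) => [|[V m] d] //= _ dV dk.
case: ifP => _; first by split=> //; case: d dV dk.
case: V => [|b V] in dk *; last by split.
by split=> //; case: d dV dk => //= x d _ /andP[_ ->].
Qed.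

(** The second component of a pair starting with ~~ i is not recorded by [runs];
    compatibility forces it to be i. *)
Lemma runsK i s : compatible i s -> labelled_blocks i (runs i s) = s.
Proof.
elim: s => //= -[a b] s IH /= /andP[ab /IH {}IH].
have [d0 _ _] := runs_normal i s; move: IH d0.
case: (runs i s) => [|[V m] d] //= <- _.
case: eqP ab => [->|/eqP ai /= /eqP ->] //.
have -> : a = ~~ i by case: a i ai => [] [].
by case: V => [|c V].
Qed.

(** Normality says that the runs are maximal: the power X_i^{k_j} is not empty,
    so V_j and V_{j+1} do not merge, and V_{j+1} is not empty, so two
    consecutive powers do not merge. *)
Lemma labelled_blocksK i d : normal d -> runs i (labelled_blocks i d) = d.
Proof.
elim: d => [|[V m] d IH] [] //= _ dV dk.
have push s x e : runs i s = x :: e -> runs i ((~~ i, i) :: s) =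
    if x.1 is [::] then ([::], x.2.+1) :: e else ([::], 1%N) :: x :: e.
  by move=> /= ->; case: (i).
(* A block whose V is empty: if it is not the last one, then m > 0 and the next
   V is not empty, so its last pair opens a new block. *)
have powers : runs i (nseq m (~~ i, i) ++ labelled_blocks i d) = ([::], m) :: d.
  case: d dV dk IH => [|[V' m'] d] /=.
    by move=> _ _ _; rewrite cats0; elim: m => //= m /push.
  move=> /andP[V'0 dV] /andP[m0 dk] /(_ (And3 isT dV dk)) IH.
  elim: m m0 => // -[_ _|m IHm _]; last exact: push (IHm isT).
  by rewrite (push _ _ _ IH); case: (V') V'0.
rewrite /labelled_blocks /= -catA [X in _ ++ _ ++ X]/=.
by elim: V {dV dk} => //= b V ->; rewrite /= eqxx.
Qed.

Lemma decP W i d : dec W i d <->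
  normal d /\ unzip2 (labelled_blocks i d) = W.
Proof. by rewrite unzip2_labelled_blocks; split=> [[]|[[]]]. Qed.

Definition compatible_words (W : word) (i : bool) : set word :=
  [set U | size U = size W /\ compatible i (zip U W)].

Lemma dec_word_bij W i : set_bij (dec W i) (compatible_words W i) (dec_word i).
Proof.
have blocksE d : dec W i d -> labelled_blocks i d = zip (dec_word i d) W.
  move=> /decP[_ <-]; rewrite -unzip1_labelled_blocks.
  by elim: (labelled_blocks i d) => //= -[a b] s <-.
split.
- move=> d dW; rewrite /compatible_words /= -(blocksE d dW); split.
    by case/decP: dW => _ <-; rewrite -unzip1_labelled_blocks !size_map.
  exact: compatible_labelled_blocks.
- move=> d e; rewrite !inE => dW eW de.
  case/decP: (dW) => /(labelled_blocksK i) <- _.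
  case/decP: (eW) => /(labelled_blocksK i) <- _.
  by rewrite !blocksE// de.
- move=> U [UW UWi] /=; exists (runs i (zip U W)).
    apply/decP; rewrite runsK// unzip2_zip ?UW//.
    by split; first exact: runs_normal.
  by rewrite -unzip1_labelled_blocks runsK// unzip1_zip ?UW.
Qed.

(** The factors are the coefficients in X_oo or X_i of the second letter of each
    pair. *)
Lemma compatible_prod (k : fieldType) i (s : seq (bool * bool)) :
  \prod_(q <- s) (if q.1 == i then -1 else (q.2 == i)%:R : k) =
  if compatible i s then (-1) ^+ count (fun q => q.1 == i) s else 0.
Proof.
elim: s => [|q s IH]; first by rewrite big_nil.
rewrite big_cons IH /=; case: (q.1 == i) => /=.
  by case: ifP; rewrite ?mulr0// exprS.
by case: (q.2 == i); rewrite /= ?mul0r ?mul1r.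
Qed.

(** The hypothesis covers with i = 0 the substitution (X_oo, X_0) and with i = 1
    the substitution (X_1, X_oo). *)
Lemma subst_dec_sum (k : fieldType) (f A B : ncseries k) (i : bool) W :
  (forall b, (if b then B else A) = if b == i then Xoo k else X k i) ->
  subst f A B W = dec_sum f i W.
Proof.
move=> AB; pose c q := if q.1 == i then -1 else (q.2 == i)%:R : k.
have coef U : wordprod (fun b => if b then B else A) U W =
    if size U == size W then \prod_(q <- zip U W) c q else 0.
  rewrite wordprod_linear => [|b]; last first.
    by rewrite AB; case: eqP => _; [exact: linear_Xoo | exact: linear_X].
  case: ifP => // _; apply: eq_bigr => q _; rewrite AB /c.
  by case: eqP => _; rewrite ?Xoo_letter ?X_letter.
rewrite /subst -(@fsbig_widen _ _ _ _ (compatible_words W i))//; last first.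
  move=> U [_ /= UWi]; rewrite coef; case: eqP => [UW|_]; last by rewrite mulr0.
  by rewrite compatible_prod; case: ifP => [?|_]; [case: UWi | rewrite mulr0].
rewrite (reindex_fsbig _ _ _ _ (dec_word_bij W i)); apply: eq_fsbigr => d.
rewrite inE => /decP[_ dW]; rewrite coef -dW -unzip1_labelled_blocks.
rewrite !size_map eqxx zip_unzip compatible_prod compatible_labelled_blocks.
by rewrite count_labelled_blocks mulrC.
Qed.

(** * Constant terms and the hexagon relation *)

Lemma nc_mul_nil (R : nzRingType) (f g : ncseries R) :
  (f * g) [::] = f [::] * g [::].
Proof. by rewrite nc_mulE big_ord_recl big_ord0 addr0. Qed.

Lemma subst_nil (k : fieldType) (f A B : ncseries k) :
  A [::] = 0 -> B [::] = 0 -> subst f A B [::] = f [::].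
Proof.
move=> A0 B0; rewrite /subst (fsum_single (x := [::])) => [|U U0].
  by rewrite /wordprod big_nil nc_oneE mulr1.
by rewrite wordprod_small ?mulr0//= lt0n size_eq0.
Qed.

Lemma ncexp_nil (k : fieldType) (a : ncseries k) :
  a [::] = 0 -> ncexp a [::] = 1.
Proof.
move=> a0; rewrite /ncexp (fsum_single (x := 0%N)) => [|n n0].
  by rewrite fact0 invr1 mul1r expr0.
by rewrite exp_small ?mulr0//= lt0n.
Qed.

(** There is no relation at the empty word, where 1 has its only nonzero
    coefficient. *)
Lemma eq1_positive_degree (R : nzRingType) (f : ncseries R) (g : word -> R) :
  f [::] = 1 -> f =1 g -> f = 1 <-> forall W, W != [::] -> g W = 0.
Proof.
move=> f1 fg; split=> [f_eq1 W /negPf W0|g0].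
  by rewrite -fg f_eq1 nc_oneE W0.
apply/funext => W; rewrite nc_oneE.
by case: eqVneq => [->//|/g0]; rewrite fg.
Qed.

Theorem theorem2p11 (k : fieldType) (chark : [pchar k] =i pred0)
    (mu : k) (mu_neq0 : mu != 0) (Phi : ncseries k)
    (Phi_gl : group_like Phi) (Phi_deg1 : forall b : bool, Phi [:: b] = 0) :
  let X0 : ncseries k := X k false in
  let X1 : ncseries k := X k true in
  let Xinf : ncseries k := Xoo k in
  ncexp ((mu / 2%:R) *: X0) * subst Phi Xinf X0
    * ncexp ((mu / 2%:R) *: Xinf) * subst Phi X1 Xinf
    * ncexp ((mu / 2%:R) *: X1) * subst Phi X0 X1 = 1
  <->
  forall W : word, W != [::] ->
    \sum_(w \in factorizations6 W)
      (let: (W1, W2, W3, W4, W5, W6) := w in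
       mu ^+ size W1 / (2 ^ size W1 * (size W1)`!)%:R * alphat k false W1
       * dec_sum Phi false W2
       * ((- 1) ^+ size W3
          * (mu ^+ size W3 / (2 ^ size W3 * (size W3)`!)%:R))
       * dec_sum Phi true W4
       * (mu ^+ size W5 / (2 ^ size W5 * (size W5)`!)%:R * alphat k true W5)
       * Phi W6) = 0.
Proof.
move=> X0 X1 Xinf; set P := _ * subst Phi X0 X1.
have P1 : P [::] = 1.
  have Phi1 : Phi [::] = 1 by case: Phi_gl.
  have X_nil b : X k b [::] = 0 by exact: linear_X.
  have Xoo_nil : Xoo k [::] = 0 by exact: linear_Xoo.
  have exp1 (a : ncseries k) : a [::] = 0 -> ncexp ((mu / 2%:R) *: a) [::] = 1.
    by move=> a0; apply: ncexp_nil; rewrite nc_scaleE a0 mulr0.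
  by rewrite /P !nc_mul_nil !exp1 ?subst_nil ?Phi1 ?mulr1.
apply: (eq1_positive_degree P1) => W; rewrite /P {P P1}.
have [_ ->] := sums_over_mul (subst Phi X0 X1)
  (sums_over_mul (ncexp ((mu / 2%:R) *: X1))
  (sums_over_mul (subst Phi X1 Xinf)
  (sums_over_mul (ncexp ((mu / 2%:R) *: Xinf))
  (sums_over_mul (subst Phi Xinf X0)
  (sums_over_self (ncexp ((mu / 2%:R) *: X0))))))) W.
(* [sums_over_mul] brackets the concatenation to the left, [factorizations6] to
   the right. *)
have -> : factorizations6 W = [set w : word * word * word * word * word * word |
    ((((w.1.1.1.1.1 ++ w.1.1.1.1.2) ++ w.1.1.1.2) ++ w.1.1.2) ++ w.1.2) ++ w.2
    = W].
  by apply/seteqP; split=> -[[[[[W1 W2] W3] W4] W5] W6] /=; rewrite !catA.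
apply: eq_fsbigr => -[[[[[W1 W2] W3] W4] W5] W6] _ /=.
rewrite subst_X !ncexp_X ncexp_Xoo.
by rewrite (@subst_dec_sum _ _ _ _ false) ?(@subst_dec_sum _ _ _ _ true)//;
  case.
Qed.
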